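(* For every even integer $n\ge 2$, there exists a happy temporal graph with $N=3n$ vertices, exactly $\frac{n(n+9)}{2}-3$ edges, and all labels in $\{1,\dots,\frac{n(n+5)}{2}-1\}$, which is temporally connected, and such that removing any subset of $5n$ of its edges results in a temporal graph that is not temporally connected.
   Context: A temporal graph is a triple $\mathcal G=(V,E,\lambda)$ where $V$ is a finite vertex set, $E$ is a set of undirected edges on $V$, and $\lambda:E\to 2^{\mathbb N}\setminus\{\emptyset\}$ assigns to each edge a nonempty set of presence times. The footprint of $\mathcal G$ is the static graph $(V,E)$. A contact is a pair $(e,t)$ with $e\in E$ and $t\in\lambda(e)$. A journey from $u$ to $v$ is a sequence of contacts $(e_1,t_1),\dots,(e_k,t_k)$, $k\ge 1$, such that $e_1,\dots,e_k$ form a path from $u$ to $v$ in the footprint and $t_1\le t_2\le\dots\le t_k$. $\mathcal G$ is proper if $\lambda(e)\cap\lambda(e')=\emptyset$ for any two distinct edges $e,e'$ sharing an endpoint (so in a proper graph the times along any journey are strictly increasing); simple if $|\lambda(e)|=1$ for every edge $e$; happy if it is both proper and simple. $\mathcal G$ is temporally connected if for every ordered pair of distinct vertices $(u,v)$ there is a journey from $u$ to $v$. Removing an edge removes it together with all its labels. *)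

(* Defs.v *)
From mathcomp Require Import all_boot.
Set Implicit Arguments. Unset Strict Implicit. Unset Printing Implicit Defensive.

(* A temporal graph on a finite vertex type V: a set of undirected edges
   (2-element vertex sets) and, for each edge, a set of presence times
   given as a predicate on nat. *)
Record tgraph (V : finType) := TGraph {
  tedges : {set {set V}};
  tlab : {set V} -> nat -> bool
}.

Section TG.
Variable V : finType.
Implicit Types (G : tgraph V).

Definition tg_wf G : Prop :=
  forall e, e \in tedges G -> #|e| = 2 /\ exists t, tlab G e t.

Definition proper G : Prop :=
  forall e e', e \in tedges G -> e' \in tedges G -> e != e' ->
    [exists x, (x \in e) && (x \in e')] ->
    forall t, ~~ (tlab G e t && tlab G e' t).

Definition simple G : Prop :=
  forall e, e \in tedges G -> exists t, forall t', tlab G e t' = (t' == t).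

Definition happy G : Prop := proper G /\ simple G.

Definition journey G (u v : V) : Prop :=
  exists (p : seq V) (ts : seq nat),
    size p > 0 /\ last u p = v /\ uniq (u :: p) /\ size ts = size p /\
    sorted leq ts /\
        (forall i, i < size p ->
          let e := [set nth u (u :: p) i; nth u p i] in
          (e \in tedges G) && tlab G e (nth 0 ts i)).

Definition temporally_connected G : Prop :=
  forall u v : V, u != v -> journey G u v.

Definition remove_edges G (F : {set {set V}}) : tgraph V :=
  TGraph (tedges G :\: F) (tlab G).

End TG.

(* Main.v *)
Require Import Defs.
From HB Require Import structures.
From mathcomp Require Import all_boot.
From mathcomp Require Import zify.
Set Implicit Arguments. Unset Strict Implicit. Unset Printing Implicit Defensive.

(**
Write n = 2k.  The complete graph on n core vertices is the edge-disjoint union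
of k Hamiltonian zigzag paths.  Path i is traversed during its own time
interval, preceded by an edge from a private source S_i and followed by edges to
D_i and then T_i; the intervals are consecutive.  For i >= 1 the source S_i meets
the core only at the beginning of interval i, and T_i hears of S_i from nowhere
else, so every journey from S_i to T_i runs through all n + 2 edges of line i.
These (k-1)(n+2) edges are thus critical, leaving 9k - 1 < 5n edges outside.

The other edges make the graph temporally connected.  Line 0 gathers the early
information into the hub D_0.  As T_i has to hear of S_j for j > i, the hub meets
E_(k-1), T_(k-2), E_(k-2), T_(k-3), ... in this order, where E_j has met S_j at
time 1: the detour through E_j keeps the hub from informing S_j, and the detour
of line i through D_i keeps T_i from informing the core.  For n = 2 the
connected graph is a 4-cycle with two further vertices, and there are fewer than
5n edges.
*)

(** * Temporal graphs presented by a list of labelled contacts *)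

Section ContactGraph.
Variables (W : finType) (T C : eqType) (f : T -> W) (g : W -> T).
Variables (src dst : C -> T) (lab : C -> nat) (cs : seq C).
Hypothesis gK : cancel g f.
Hypothesis src_f : {in cs, forall c, g (f (src c)) = src c}.
Hypothesis dst_f : {in cs, forall c, g (f (dst c)) = dst c}.

(** Contacts have their ends in a convenient type [T], whereas [tgraph] needs a finite type [W]. The
    map [g] embeds [W] in [T], and [f] retracts [T] onto [W], faithfully on the ends of the listed
    contacts. *)
Definition edge_of c : {set W} := [set f (src c); f (dst c)].

Definition contact_graph : tgraph W :=
  TGraph [set e in map edge_of cs]
         (fun e t => has (fun c => (edge_of c == e) && (lab c == t)) cs).

Lemma in_contact_graphP e t :
  reflect (exists2 c, c \in cs & edge_of c = e /\ lab c = t)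
          ((e \in tedges contact_graph) && tlab contact_graph e t).
Proof.
apply: (iffP andP) => [[_ /hasP[c ccs /andP[/eqP ec /eqP lc]]]|[c ccs [<- <-]]].
  by exists c.
split; first by rewrite inE map_f.
by apply/hasP; exists c; rewrite ?eqxx.
Qed.

Definition ends c : pred T := [pred v | (v == src c) || (v == dst c)].

Lemma mem_edge_of c w : c \in cs -> (w \in edge_of c) = (g w \in ends c).
Proof.
move=> ccs; rewrite !inE -(inj_eq (can_inj gK)) -(inj_eq (can_inj gK) w (f (dst c))).
by rewrite src_f ?dst_f.
Qed.

Hypothesis loopless : {in cs, forall c, src c != dst c}.
Hypothesis ends_inj : {in cs &, forall c c', ends c =i ends c' -> c = c'}.

Lemma edge_of_inj : {in cs &, injective edge_of}.
Proof.
move=> c c' ccs ccs' eq_e; apply: ends_inj => // v.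
have eqP_ w : (g w \in ends c) = (g w \in ends c').
  by rewrite -!mem_edge_of // eq_e.
(* Equal edges only allow the ends to be compared on the image of [g], but the ends of listed
   contacts lie in that image. *)
have sub c1 c2 : c1 \in cs -> c2 \in cs ->
    (forall w, (g w \in ends c1) = (g w \in ends c2)) -> v \in ends c1 -> v \in ends c2.
  move=> h1 h2 h12 v1; have gv : g (f v) = v.
    by move: v1; rewrite inE => /orP[] => /eqP ->; rewrite ?src_f ?dst_f.
  by have := h12 (f v); rewrite gv v1 => <-.
by apply/idP/idP; apply: sub => // w; rewrite eqP_.
Qed.

Lemma contact_graph_wf : tg_wf contact_graph.
Proof.
move=> e; rewrite inE => /mapP[c ccs ->]; split.
  by rewrite cards2 -(inj_eq (can_inj gK)) src_f ?dst_f ?loopless.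
by exists (lab c); apply/hasP; exists c; rewrite ?eqxx.
Qed.

Lemma contact_graph_simple : simple contact_graph.
Proof.
move=> e; rewrite inE => /mapP[c ccs ->]; exists (lab c) => t'.
apply/hasP/eqP => [[c' ccs' /andP[/eqP ec /eqP <-]]|->].
  by rewrite (edge_of_inj ccs' ccs ec).
by exists c; rewrite ?eqxx.
Qed.

Lemma contact_graph_proper :
  {in cs &, forall c c' v, v \in ends c -> v \in ends c' -> lab c = lab c' -> c = c'} ->
  Defs.proper contact_graph.
Proof.
move=> lab_inj e e' _ _ nee' /existsP[x /andP[xe xe']] t.
apply: contra nee' => /andP[/hasP[c ccs /andP[/eqP ec /eqP lc]]].
move=> /hasP[c' ccs' /andP[/eqP ec' /eqP lc']].
rewrite -ec -ec'; apply/eqP; congr edge_of.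
apply: (lab_inj _ _ ccs ccs' (g x)); last by rewrite lc lc'.
  by rewrite -mem_edge_of ?ec.
by rewrite -mem_edge_of ?ec'.
Qed.

Lemma card_contact_graph : uniq cs -> #|tedges contact_graph| = size cs.
Proof.
move=> ucs; rewrite cardsE -(size_map edge_of); apply/card_uniqP.
by rewrite map_inj_in_uniq //; apply: edge_of_inj.
Qed.

(* [reach u a v b]: leaving [u] at time [a], one can be at [v] at time [b];
   waiting is allowed and vertices may be revisited. *)
Inductive reach (u : T) (a : nat) : T -> nat -> Prop :=
| reach_here : reach u a u a
| reach_wait v b b' : reach u a v b -> b <= b' -> reach u a v b'
| reach_fwd c b : reach u a (src c) b -> c \in cs -> b <= lab c -> reach u a (dst c) (lab c)
| reach_bwd c b : reach u a (dst c) b -> c \in cs -> b <= lab c -> reach u a (src c) (lab c).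

Lemma reach_trans u a v b w d : reach u a v b -> reach v b w d -> reach u a w d.
Proof.
move=> uv; elim=> // {w d} [w d d' _|c d _|c d _].
- exact: reach_wait.
- exact: reach_fwd.
- exact: reach_bwd.
Qed.

(** The empty path is allowed and [b] bounds every label, so that the notion survives waiting and
    truncation in an induction on [reach]. *)
Definition journey_by (u v : W) (b : nat) : Prop :=
  exists (p : seq W) (ts : seq nat),
    [/\ last u p = v, uniq (u :: p), size ts = size p,
        sorted leq ts /\ all (leq^~ b) ts &
        forall i, i < size p ->
          let e := [set nth u (u :: p) i; nth u p i] in
          (e \in tedges contact_graph) && tlab contact_graph e (nth 0 ts i)].

(* A step to a vertex already visited is replaced by truncation. *)
Lemma journey_by_step u v w b t : journey_by u v b -> b <= t ->
  ([set v; w] \in tedges contact_graph) && tlab contact_graph [set v; w] t ->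
  journey_by u w t.
Proof.
move=> [p [ts [lp up sts [sorted_ts ts_b] steps]]] b_t vw.
have [w_in|w_notin] := boolP (w \in u :: p).
  have : index w (u :: p) <= size p by rewrite -ltnS index_mem.
  have : nth u (u :: p) (index w (u :: p)) = w by apply: nth_index.
  move: (index _ _) => i nth_i i_p.
  exists (take i p), (take i ts); split.
  - rewrite -nth_i; case: i i_p {nth_i} => [|i] i_p; first by rewrite take0.
    by rewrite (take_nth u) // last_rcons.
  - by apply: subseq_uniq up; rewrite /= eqxx take_subseq.
  - by rewrite !size_takel ?sts.
  - split; first by apply: take_sorted.
    apply/allP => x /mem_take x_ts; apply: leq_trans b_t.
    exact: (allP ts_b).
  - move=> j; rewrite size_takel // => j_i.
    have := steps j (leq_trans j_i i_p); rewrite !nth_take //.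
    by case: j j_i => // j j_i /=; rewrite nth_take // ltnW.
exists (rcons p w), (rcons ts t); split.
- by rewrite last_rcons.
- by rewrite -rcons_cons rcons_uniq w_notin.
- by rewrite !size_rcons sts.
- split; last first.
    rewrite all_rcons leqnn /=; apply/allP => x x_ts; apply: leq_trans b_t.
    exact: (allP ts_b).
  case: ts sorted_ts ts_b {sts steps} => //= x ts path_ts /andP[x_b ts_b].
  rewrite rcons_path path_ts /=; apply: leq_trans b_t.
  by have := mem_last x ts; rewrite inE => /orP[/eqP -> //|]; apply: (allP ts_b).
- move=> i; rewrite size_rcons ltnS leq_eqVlt => /orP[/eqP ->|i_p].
    by rewrite -rcons_cons !nth_rcons /= sts ltnn eqxx ltnSn -last_nth lp.
  have := steps i i_p; rewrite -rcons_cons !nth_rcons /= sts i_p.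
  by rewrite ltnS (ltnW i_p).
Qed.

Lemma reach_journey_by u a v b : reach u a v b -> journey_by (f u) (f v) b.
Proof.
elim=> {v b} [|v b b' _ [p [ts [lp up sts [so al] st]]] bb'|c b _ IH ccs bc|c b _ IH ccs bc].
- by exists [::], [::]; split.
- exists p, ts; split => //; split => //; apply/allP => x /(allP al) xb.
  exact: leq_trans xb bb'.
- apply: journey_by_step IH bc _.
  by apply/in_contact_graphP; exists c.
- apply: journey_by_step IH bc _.
  by apply/in_contact_graphP; exists c => //; rewrite /edge_of setUC.
Qed.

Lemma contact_graph_connected :
  (forall u v, u \in codom g -> v \in codom g -> u != v -> exists b, reach u 0 v b) ->
  temporally_connected contact_graph.
Proof.
move=> conn u v uv.
have [|b /reach_journey_by] := conn (g u) (g v) (codom_f g u) (codom_f g v).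
  by rewrite (inj_eq (can_inj gK)).
rewrite !gK => -[p [ts [lp up sts [so _] st]]].
exists p, ts; do ![split=> //].
by case: p lp {up sts st} => //= E; rewrite E eqxx in uv.
Qed.

(* [alpha v] is a lower bound for the time of arrival at [v] from [u]. *)
Lemma contact_critical (alpha : T -> nat) (u v : T) (c0 : C) (F : {set {set W}}) :
  u \in codom g -> v \in codom g -> u != v ->
  alpha u = 0 -> {in cs, forall c, lab c < alpha v} ->
  {in cs, forall c, c != c0 -> (alpha (src c) <= lab c) = (alpha (dst c) <= lab c)} ->
  edge_of c0 \in F -> ~ temporally_connected (remove_edges contact_graph F).
Proof.
move=> /codomP[x ->] /codomP[y ->] xy ax ay closed_alpha c0F conn.
have {xy} : x != y by apply: contra xy => /eqP ->.
move=> /(conn x y)[p [ts [p0 [lp [_ [sts [so st]]]]]]].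
have step i : i < size p -> exists2 c, c \in cs & lab c = nth 0 ts i /\
    (alpha (g (nth x (x :: p) i)) <= lab c -> alpha (g (nth x p i)) <= lab c).
  move=> ip; have := st i ip; rewrite /= inE -andbA => /andP[eF /in_contact_graphP].
  case=> c ccs [ec lc]; exists c => //; split => //.
  have cc0 : c != c0 by apply: contraNneq eF => cE; rewrite -ec cE.
  have := closed_alpha c ccs cc0.
  (* The journey may cross [c] in either direction; the equivalence [closed_alpha] covers both. *)
  have : g (nth x (x :: p) i) \in ends c by rewrite -mem_edge_of // ec !inE eqxx.
  have : g (nth x p i) \in ends c by rewrite -mem_edge_of // ec !inE eqxx orbT.
  by rewrite !inE => /orP[]/eqP-> /orP[]/eqP-> => // ->.
have reached i : i < size p -> alpha (g (nth x p i)) <= nth 0 ts i.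
  elim: i => [|i IH] ip; have [c _ [lc ac]] := step _ ip; rewrite -lc.
    by apply: ac; rewrite /= ax.
  apply: ac; rewrite lc; apply: leq_trans (IH (ltnW ip)) _.
  by apply: (sorted_leq_nth leq_trans leqnn) => //; rewrite inE sts // ltnW.
(* The label of the last contact would be at least [alpha (g y)], which exceeds all labels. *)
have last_p : (size p).-1 < size p by rewrite prednK.
have [c ccs [lc _]] := step _ last_p.
have := reached _ last_p; rewrite -lc leqNgt nth_last.
have -> : last x p = y by [].
by rewrite ay.
Qed.
End ContactGraph.

(** * Decomposition of a complete graph into Hamiltonian zigzags *)

(** Walecki's path [i, i+1, i-1, i+2, ...] modulo [2k], with the reduction written out as case
    distinctions that [lia] can follow. *)
Definition zigzag (k i p : nat) : nat :=
  if odd p then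
    (if i + p./2.+1 < k.*2 then i + p./2.+1 else i + p./2.+1 - k.*2)
  else (if p./2 <= i then i - p./2 else i + k.*2 - p./2).

Definition zigrank (k i x : nat) : nat :=
  if x <= i then (i - x).*2
  else if x - i <= k then (x - i).*2.-1 else (i + k.*2 - x).*2.

Ltac iflia := repeat case: ifP; intros; lia.

Lemma zigzag_lt k i p : i < k -> p < k.*2 -> zigzag k i p < k.*2.
Proof. rewrite /zigzag; iflia. Qed.

Lemma zigrank_lt k i x : i < k -> x < k.*2 -> zigrank k i x < k.*2.
Proof. rewrite /zigrank; iflia. Qed.

Lemma zigzagK k i p : i < k -> p < k.*2 -> zigrank k i (zigzag k i p) = p.
Proof. rewrite /zigzag /zigrank; iflia. Qed.

Lemma zigrankK k i x : i < k -> x < k.*2 -> zigzag k i (zigrank k i x) = x.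
Proof. rewrite /zigzag /zigrank; iflia. Qed.

Lemma zigzag0 k i : zigzag k i 0 = i.
Proof. by rewrite /zigzag /= subn0. Qed.

Lemma zigzag_last k i : i < k -> zigzag k i k.*2.-1 = i + k.
Proof. rewrite /zigzag; iflia. Qed.

(* Modulo 2k the sum identifies the zigzag, whence edge-disjointness. *)
Lemma zigzag_sum k i p : i < k -> p.+1 < k.*2 ->
  let s := zigzag k i p + zigzag k i p.+1 in
  s = i.*2 + ~~ odd p \/ s = i.*2 + ~~ odd p + k.*2.
Proof. rewrite /zigzag; iflia. Qed.

(** The two edges have the same ends, hence the same sum. As [i < k], the number [i.*2 + ~~ odd p]
    is below [2k], so the sum modulo [2k] determines it and thereby [i]; the positions on the common
    path then give [p]. *)
Lemma zigzag_edge_inj k i p i' p' :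
  i < k -> p.+1 < k.*2 -> i' < k -> p'.+1 < k.*2 ->
  let x := zigzag k i p in let y := zigzag k i p.+1 in
  let x' := zigzag k i' p' in let y' := zigzag k i' p'.+1 in
  x = x' \/ x = y' -> y = x' \/ y = y' -> i = i' /\ p = p'.
Proof.
move=> ik pk ik' pk' x y x' y' hx hy.
have xK : zigrank k i x = p by apply: zigzagK => //; lia.
have yK : zigrank k i y = p.+1 by apply: zigzagK.
have x'K : zigrank k i' x' = p' by apply: zigzagK => //; lia.
have y'K : zigrank k i' y' = p'.+1 by apply: zigzagK.
have sum : x + y = i.*2 + ~~ odd p \/ x + y = i.*2 + ~~ odd p + k.*2.
  exact: zigzag_sum.
have sum' : x' + y' = i'.*2 + ~~ odd p' \/ x' + y' = i'.*2 + ~~ odd p' + k.*2.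
  exact: zigzag_sum.
clearbody x y x' y'.
have xy : x <> y by move=> E; move: xK yK; rewrite E; lia.
have Ei : i = i' by lia.
subst i'; split=> //.
by case: hx => Ex; case: hy => Ey; subst; lia.
Qed.

(* [VA] are the core vertices; [VD 0] is the hub. *)
Inductive vertex := VA of nat | VS of nat | VD of nat | VT of nat | VE of nat.

(* A constructor is named after the classes of its ends, [C] being the hub
   ([TZ] is the late edge of [VT 0] to the core);
   [Path i q] is the [q]-th edge of the [i]-th zigzag. *)
Inductive contact :=
| SE of nat | TA of nat | DA of nat | Entry of nat | Path of nat & nat
| Exit of nat | DT of nat | CA | CT of nat | CE of nat | CS of nat
| EA of nat | TZ.

Lemma vertex_eq_dec : comparable vertex.
Proof. by move=> u v; red; repeat decide equality. Qed.
HB.instance Definition _ := hasDecEq.Build vertex (compareP vertex_eq_dec).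

Lemma contact_eq_dec : comparable contact.
Proof. by move=> u v; red; repeat decide equality. Qed.
HB.instance Definition _ := hasDecEq.Build contact (compareP contact_eq_dec).

(** * The graph for [n = 2k] with [k > 1]: contacts, labels and vertex numbering *)

Section Construction.
Variable k : nat.
Hypothesis k_gt1 : 1 < k.

(** An interval holds [2k + 2] labels: entry, [2k - 1] zigzag edges, exit and final edge. Label 1 is
    kept for the contacts before all intervals, and [start k] is the first label after them. *)
Definition start (j : nat) : nat := 2 + j * (k.*2 + 2).
Local Notation B := start.
Local Notation L := (start k).

Lemma start0 : B 0 = 2. Proof. by []. Qed.

Lemma start_ge2 j : 2 <= B j. Proof. by rewrite /start. Qed.

Lemma start_lt i j : i < j -> B i + k.*2 + 2 <= B j.
Proof.
rewrite /start -!addnA leq_add2l -mulSnr => ij; exact: leq_mul.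
Qed.

Lemma start_le i j : i <= j -> B i <= B j.
Proof. by rewrite /start leq_add2l => ij; apply: leq_mul. Qed.

Definition src (c : contact) : vertex :=
  match c with
  | SE j => VS j | TA j => VT j | DA j => VD j | Entry j => VS j
  | Path i q => VA (zigzag k i q) | Exit j => VA (j + k) | DT j => VD j
  | CA | CT _ | CE _ | CS _ => VD 0
  | EA j => VE j | TZ => VT 0
  end.

(** The index [(k + j).-1] in [DA j] avoids both the edge of [Exit j] and the core vertices used by
    [TA] at the same time 1. [CA] ends at [VA 1], where zigzag 1 begins. *)
Definition dst (c : contact) : vertex :=
  match c with
  | SE j => VE j | TA j => VA j | DA j => VA (k + j).-1 | Entry j => VA j
  | Path i q => VA (zigzag k i q.+1) | Exit j => VD j | DT j => VT j
  | CA => VA 1 | CT j => VT j | CE j => VE j | CS j => VS j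
  | EA j => VA j | TZ => VA k
  end.

Definition lab (c : contact) : nat :=
  match c with
  | SE _ | TA _ | DA _ => 1
  | Entry j => B j | Path i q => B i + q.+1 | Exit j => B j + k.*2
  | DT j => B j + k.*2.+1 | CA => B 0 + k.*2.+1
  | CT j => B 1 + (k - j).*2.-1 | CE j => B 1 + (k - j).*2
  | CS j => L - j | EA _ | TZ => L
  end.

Definition valid_contact (c : contact) : bool :=
  match c with
  | SE j | TA j | Entry j | Exit j | CS j | EA j => j < k
  | DA j | DT j | CE j => 0 < j < k
  | Path i q => (i < k) && (q.+1 < k.*2)
  | CT j => 0 < j < k.-1
  | CA | TZ => true
  end.

Definition contacts : seq contact :=
  [seq SE j | j <- iota 0 k] ++ [seq TA j | j <- iota 0 k] ++
  [seq DA j | j <- iota 1 k.-1] ++ [seq Entry j | j <- iota 0 k] ++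
  [seq Path i q | i <- iota 0 k, q <- iota 0 k.*2.-1] ++
  [seq Exit j | j <- iota 0 k] ++ [seq DT j | j <- iota 1 k.-1] ++
  [:: CA] ++ [seq CT j | j <- iota 1 k.-2] ++ [seq CE j | j <- iota 1 k.-1] ++
  [seq CS j | j <- iota 0 k] ++ [seq EA j | j <- iota 0 k] ++ [:: TZ].

Lemma mem_contacts c : (c \in contacts) = valid_contact c.
Proof.
rewrite /contacts !mem_cat !mem_seq1; apply/idP/idP.
  repeat case/orP; try (by move/eqP->);
    try (case/mapP => j; rewrite mem_iota => jk ->; rewrite /=; lia).
  by case/allpairsP => -[i q] /= []; rewrite !mem_iota => ik qk ->; rewrite /=; lia.
case: c => [j|j|j|j|i q|j|j||j|j|j|j|] /= valid;
  try (by rewrite eqxx ?orbT);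
  try (by rewrite map_f ?orbT // mem_iota; lia).
by rewrite allpairs_f ?orbT // mem_iota; lia.
Qed.

Lemma size_contacts : size contacts = k * (k.*2 + 9) - 3.
Proof.
rewrite /contacts !size_cat size_allpairs !size_map !size_iota /=.
by rewrite -!muln2; nia.
Qed.

Lemma contacts_uniq : uniq contacts.
Proof.
have Uq : uniq [seq Path i q | i <- iota 0 k, q <- iota 0 k.*2.-1].
  by apply: allpairs_uniq; rewrite ?iota_uniq // => -[? ?] [? ?] _ _ [-> ->].
rewrite /contacts !cat_uniq Uq !map_inj_uniq ?iota_uniq //;
  try (by move=> ? ? []).
(* Distinct blocks of the list use distinct constructors. *)
repeat (apply/andP; split=> //); apply/hasPn => c; rewrite ?mem_cat ?mem_seq1;
  repeat case/orP;
  [> (case/mapP => ? _ -> || case/allpairsP => -[? ?] [_ _ ->] || move/eqP->) ..];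
  first [by apply/negP => /mapP[] | by apply/negP => /allpairsP[? []] | by apply/eqP].
Qed.

Definition valid_vertex (v : vertex) : bool :=
  match v with VA x => x < k.*2 | VS j | VD j | VT j | VE j => j < k end.

Definition code (v : vertex) : nat :=
  match v with
  | VA x => x | VS j => k.*2 + j | VD j => 3 * k + j
  | VT j => 4 * k + j | VE j => 5 * k + j
  end.

Definition decode (w : nat) : vertex :=
  if w < k.*2 then VA w else if w < 3 * k then VS (w - k.*2)
  else if w < 4 * k then VD (w - 3 * k) else if w < 5 * k then VT (w - 4 * k)
  else VE (w - 5 * k).

Lemma code_lt v : valid_vertex v -> code v < 3 * k.*2.
Proof. case: v => j /=; lia. Qed.

Lemma codeK v : valid_vertex v -> decode (code v) = v.
Proof.
by case: v => j /= hj; rewrite /decode; repeat case: ifP; intros; try lia; congr (_ _); lia.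
Qed.

Lemma decodeK w : code (decode w) = w.
Proof. rewrite /decode; repeat case: ifP => /=; lia. Qed.

Lemma valid_decode w : w < 3 * k.*2 -> valid_vertex (decode w).
Proof. rewrite /decode; repeat case: ifP => /=; lia. Qed.

Lemma order_gt0 : 0 < 3 * k.*2. Proof. lia. Qed.

Definition ord_of (v : vertex) : 'I_(3 * k.*2) := insubd (Ordinal order_gt0) (code v).
Definition vertex_of (w : 'I_(3 * k.*2)) : vertex := decode w.

Lemma vertex_ofK : cancel vertex_of ord_of.
Proof.
by move=> w; apply: val_inj; rewrite /ord_of val_insubd decodeK ltn_ord.
Qed.

Lemma ord_ofK v : valid_vertex v -> vertex_of (ord_of v) = v.
Proof. by move=> hv; rewrite /vertex_of /ord_of val_insubd code_lt ?codeK. Qed.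

Lemma codom_vertex_of v : (v \in codom vertex_of) = valid_vertex v.
Proof.
apply/idP/idP => [/codomP[w ->]|hv]; first exact: valid_decode.
by rewrite -(ord_ofK hv) codom_f.
Qed.

Lemma valid_src c : valid_contact c -> valid_vertex (src c).
Proof.
case: c => [j|j|j|j|i q|j|j||j|j|j|j|] //=; try lia.
by case/andP => ik qk; apply: zigzag_lt => //; lia.
Qed.

Lemma valid_dst c : valid_contact c -> valid_vertex (dst c).
Proof.
case: c => [j|j|j|j|i q|j|j||j|j|j|j|] //=; try lia.
by case/andP => ik qk; apply: zigzag_lt => //; lia.
Qed.

Lemma contacts_loopless : {in contacts, forall c, src c != dst c}.
Proof.
move=> c; rewrite mem_contacts; case: c => [j|j|j|j|i q|j|j||j|j|j|j|] /= hc; apply/eqP => //.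
case=> E; case/andP: hc => ik qk.
by have := zigzagK ik qk; rewrite -E zigzagK //; lia.
Qed.

Ltac destruct_ends :=
  repeat match goal with
  | H : _ \/ _ |- _ => case: H => H
  | H : VA _ = VA _ |- _ => case: H => H
  | H : VS _ = VS _ |- _ => case: H => H
  | H : VD _ = VD _ |- _ => case: H => H
  | H : VT _ = VT _ |- _ => case: H => H
  | H : VE _ = VE _ |- _ => case: H => H
  end.

(** The classes and indices of the ends separate all contacts except two zigzag edges, which are
    left to [zigzag_edge_inj]. *)
Lemma contacts_ends_inj : {in contacts &, forall c c', ends src dst c =i ends src dst c' -> c = c'}.
Proof.
move=> c c' c_in; have /eqP := contacts_loopless c_in.
move: c_in; rewrite !mem_contacts => hc ne hc' E.
have Es : src c = src c' \/ src c = dst c'.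
  by have := E (src c); rewrite !inE eqxx => /esym/orP[]/eqP; [left|right].
have Ed : dst c = src c' \/ dst c = dst c'.
  by have := E (dst c); rewrite !inE eqxx orbT => /esym/orP[]/eqP; [left|right].
move: hc hc' ne Es Ed {E}.
case: c => [j|j|j|j|i q|j|j||j|j|j|j|];
  case: c' => [j'|j'|j'|j'|i' q'|j'|j'||j'|j'|j'|j'|] /= hc hc' ne Es Ed;
  try (by []); try (destruct_ends; first [by [] | congruence | exfalso; lia | congr (_ _); lia]).
have {}Es : zigzag k i q = zigzag k i' q' \/ zigzag k i q = zigzag k i' q'.+1.
  by case: Es => -[]; [left|right].
have {}Ed : zigzag k i q.+1 = zigzag k i' q' \/ zigzag k i q.+1 = zigzag k i' q'.+1.
  by case: Ed => -[]; [left|right].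
case/andP: hc => ik qk; case/andP: hc' => ik' qk'.
by have [-> ->] := zigzag_edge_inj ik qk ik' qk' Es Ed.
Qed.

(* [0] for contacts outside the lines. *)
Definition line (c : contact) : nat :=
  match c with Entry i | Path i _ | Exit i | DT i => i | _ => 0 end.

(** Lines use disjoint intervals, with increasing labels inside each. Contacts labelled 1 are
    pairwise disjoint, as are those labelled [L]; at the hub, [CT] and [CE] differ in parity and
    precede [CS]. *)
Lemma contacts_lab_inj :
  {in contacts &, forall c c' v, v \in ends src dst c -> v \in ends src dst c' ->
    lab c = lab c' -> c = c'}.
Proof.
move=> c c'; rewrite !mem_contacts => hc hc' v; rewrite !inE => /orP v_c /orP v_c' El.
have E : (src c = src c' \/ src c = dst c') \/ (dst c = src c' \/ dst c = dst c').
  by case: v_c => /eqP vc; case: v_c' => /eqP vc'; rewrite -!vc -!vc'; tauto.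
(* The product in [start] is nonlinear; these instances place the two lines relative to each other
   and to 0, 1, 2 and [k]. *)
have := @start_le (line c) (line c'); have := @start_lt (line c) (line c').
have := @start_le (line c') (line c); have := @start_lt (line c') (line c).
have := @start_lt (line c) k; have := @start_lt (line c') k.
have := @start_le 1 (line c); have := @start_le 1 (line c').
have := @start_lt 0 1; have := @start_lt 1 2; have := @start_lt 2 k.
have := start0; have := @start_le (line c) 0; have := @start_le (line c') 0.
have := @start_le 2 k; have := start_ge2 (line c); have := start_ge2 (line c').
move: hc hc' E El; clear v v_c v_c'.
case: c => [j|j|j|j|i q|j|j||j|j|j|j|];
  case: c' => [j'|j'|j'|j'|i' q'|j'|j'||j'|j'|j'|j'|] /= hc hc' E El;
  intros; try (by []); try (exfalso; lia);
  try (destruct_ends;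
       first [by [] | exfalso; lia | congr (_ _); lia | congr (Path _ _); lia]).
Qed.

(** * Temporal connectivity *)

Local Notation R := (reach src dst lab contacts).

Lemma hop_fwd c u a b : valid_contact c -> b <= lab c ->
  R u a (src c) b -> R u a (dst c) (lab c).
Proof. by move=> hc bc h; apply: reach_fwd h _ bc; rewrite mem_contacts. Qed.

Lemma hop_bwd c u a b : valid_contact c -> b <= lab c ->
  R u a (dst c) b -> R u a (src c) (lab c).
Proof. by move=> hc bc h; apply: reach_bwd h _ bc; rewrite mem_contacts. Qed.

Lemma reach_zigzag i p d : i < k -> p + d < k.*2 ->
  R (VA (zigzag k i p)) (B i + p) (VA (zigzag k i (p + d))) (B i + (p + d)).
Proof.
move=> ik; elim: d => [|d IH] pd; first by rewrite addn0; apply: reach_here.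
rewrite addnS; apply: (@hop_fwd (Path i (p + d))) (IH _); rewrite /=; lia.
Qed.

Lemma reach_core i x : i < k -> x < k.*2 -> R (VA i) (B i) (VA x) (B i + k.*2.-1).
Proof.
move=> ik xk; have rk := zigrank_lt ik xk.
have := @reach_zigzag i 0 (zigrank k i x) ik rk.
rewrite add0n zigzag0 addn0 zigrankK // => h; apply: reach_wait h _; lia.
Qed.

(** Zigzag 0 passes through every core vertex: one waits at [VA x] for its turn, rides the rest to
    [VA k], and leaves by [Exit 0]. *)
Lemma reach_hub x : x < k.*2 -> R (VA x) 1 (VD 0) (B 0 + k.*2).
Proof.
move=> xk; have k0 : 0 < k by lia.
have rk := zigrank_lt k0 xk; have := start0 => B0.
apply: (@reach_trans _ _ _ _ _ _ _ _ (VA x) (B 0 + zigrank k 0 x)).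
  by apply: reach_wait (reach_here _ _ _ _ _ _) _; lia.
apply: (@hop_fwd (Exit 0) _ _ (B 0 + k.*2.-1)) => //=; first lia.
have := @reach_zigzag 0 (zigrank k 0 x) (k.*2.-1 - zigrank k 0 x) k0.
by rewrite subnKC ?zigrankK ?zigzag_last //; [apply; lia | lia].
Qed.

(** These are the vertices served once zigzag [i] is complete: by [Exit] and [DT] on lines from [i]
    on, and by [EA] and [TZ] at the end. *)
Lemma reach_from_core u i v : 0 < i < k ->
  (forall x, x < k.*2 -> R u 0 (VA x) (B i + k.*2.-1)) -> valid_vertex v ->
  match v with
  | VA _ | VE _ => True | VS _ => False | VD j => i <= j
  | VT j => j = 0 \/ i <= j
  end -> exists b, R u 0 v b.
Proof.
move=> ik core; have Bik := @start_lt i k.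
have exit j : j < k -> i <= j -> R u 0 (VD j) (B j + k.*2).
  move=> jk ij; have := start_le ij => Bij.
  by apply: (@hop_fwd (Exit j) _ _ _ _ _ (core (j + k) _)) => /=; lia.
case: v => [x|//|j|j|j] /= jk cond.
- by exists (B i + k.*2.-1); apply: core.
- by exists (B j + k.*2); apply: exit.
- have [j0|jn0] := eqVneq j 0.
    exists L; rewrite j0; apply: (@hop_bwd TZ _ _ _ _ _ (core k _)) => /=; lia.
  exists (B j + k.*2.+1); apply: (@hop_fwd (DT j) _ _ _ _ _ (exit j _ _)) => /=; lia.
- exists L; apply: (@hop_bwd (EA j) _ _ _ _ _ (core j _)) => /=; lia.
Qed.

(** [CA] hands the information to [VA 1] just before interval 1, so every line from 1 on carries it;
    the sources are served by [CS]. *)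
Lemma reach_from_hub u v : R u 0 (VD 0) (B 0 + k.*2) -> valid_vertex v ->
  exists b, R u 0 v b.
Proof.
move=> hub hv; have B01 := @start_lt 0 1; have B1k := @start_lt 1 k.
have B0 := start0.
have core x : x < k.*2 -> R u 0 (VA x) (B 1 + k.*2.-1).
  move=> xk; apply: reach_trans (reach_core k_gt1 xk).
  apply: (@reach_wait _ _ _ _ _ _ _ _ _ (B 0 + k.*2.+1)); last lia.
  by apply: (@hop_fwd CA _ _ _ _ _ hub) => //=; lia.
case: v hv => [x|j|j|j|j] hv; try (by apply: (reach_from_core _ core hv) => /=; lia).
- exists (L - j); apply: (@hop_fwd (CS j) _ _ _ _ _ hub) => //=.
  by move: hv => /=; lia.
- have [->|j0] := eqVneq j 0; first by exists (B 0 + k.*2).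
  by apply: (reach_from_core _ core hv) => /=; lia.
Qed.

(** Lines [j < i] are over before interval [i], so [VT j] is reached through the hub, [CE i]
    preceding [CT j], and [VD j] by [DT j] taken backwards. Assuming both [VS i] and [VE i] known at
    time 1 serves either as origin. *)
Lemma reach_from_source u i v : 0 < i < k ->
  R u 0 (VS i) 1 -> R u 0 (VE i) 1 -> valid_vertex v -> exists b, R u 0 v b.
Proof.
move=> ik us ue hv; have ik' : i < k by lia.
have B01 := @start_lt 0 1; have B1i := @start_le 1 i; have Bi2 := start_ge2 i.
have B12 := @start_lt 1 2; have B2k := @start_le 2 k; have B2k' := @start_lt 2 k.
have core x : x < k.*2 -> R u 0 (VA x) (B i + k.*2.-1).
  move=> xk; apply: reach_trans (reach_core ik' xk).
  by apply: (@hop_fwd (Entry i) _ _ _ _ _ us) => //=; lia.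
have hub : R u 0 (VD 0) (B 1 + (k - i).*2).
  by apply: (@hop_bwd (CE i) _ _ _ _ _ ue) => /=; lia.
have sink j : 0 < j < i -> R u 0 (VT j) (B 1 + (k - j).*2.-1).
  by move=> ji; apply: (@hop_fwd (CT j) _ _ _ _ _ hub) => /=; lia.
case: v hv => [x|j|j|j|j] hv; try (by apply: (reach_from_core _ core hv)).
- exists (L - j); apply: (@hop_fwd (CS j) _ _ _ _ _ hub) => //=.
  by move: hv => /=; lia.
- have [->|j0] := eqVneq j 0; first by exists (B 1 + (k - i).*2).
  have [ij|ji] := leqP i j; first by apply: (reach_from_core _ core hv).
  have ji' : 0 < j < i by lia.
  have B1j := @start_le 1 j.
  exists (B j + k.*2.+1); apply: (@hop_bwd (DT j) _ _ _ _ _ (sink j ji')) => /=; lia.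
- have [ij|ji] := leqP i j; first by apply: (reach_from_core _ core hv) => //; right.
  have [->|j0] := eqVneq j 0.
    by apply: (@reach_from_core _ i) => //=; [lia | left].
  by exists (B 1 + (k - j).*2.-1); apply: sink; lia.
Qed.

Lemma reach_from_start0 u v : R u 0 (VS 0) 1 -> valid_vertex v -> exists b, R u 0 v b.
Proof.
move=> us; apply: reach_from_hub; have k0 : 0 < k by lia.
apply: (@hop_fwd (Exit 0) _ _ (B 0 + k.*2.-1)) => //=; first lia.
apply: reach_trans (@reach_core 0 (0 + k) k0 _); last lia.
by apply: (@hop_fwd (Entry 0) _ _ _ _ _ us).
Qed.

(** Contacts at time 1 bring every origin other than a core vertex or the hub to the core or to both
    ends of an [SE] edge. *)
Lemma contacts_reach u v : valid_vertex u -> valid_vertex v -> exists b, R u 0 v b.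
Proof.
move=> hu hv; have here w : R w 0 w 0 by apply: reach_here.
have here1 w : R w 0 w 1 by apply: reach_wait (here w) _.
have from_line j : j < k -> R u 0 (VS j) 1 -> R u 0 (VE j) 1 -> exists b, R u 0 v b.
  move=> jk us ue; have [j0|j0] := eqVneq j 0.
    by subst j; apply: reach_from_start0 us hv.
  by apply: reach_from_source us ue hv; lia.
case: u hu from_line => [x|j|j|j|j] /= hu from_line.
- by apply: reach_from_hub hv; apply: reach_trans (here1 _) (reach_hub hu).
- apply: (from_line j) => //.
  by apply: (@hop_fwd (SE j) _ _ _ _ _ (here _)).
- apply: reach_from_hub hv; have [->|j0] := eqVneq j 0.
    by apply: reach_wait (here _) _.
  apply: reach_trans (@reach_hub (k + j).-1 _); last lia.
  by apply: (@hop_fwd (DA j) _ _ _ _ _ (here _)) => //=; lia.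
- apply: reach_from_hub hv; apply: reach_trans (@reach_hub j _); last lia.
  by apply: (@hop_fwd (TA j) _ _ _ _ _ (here _)).
- apply: (from_line j) => //.
  by apply: (@hop_bwd (SE j) _ _ _ _ _ (here _)).
Qed.

(** * Critical edges and the count *)

Definition line_contact (i q : nat) : contact :=
  if q == 0 then Entry i else if q < k.*2 then Path i q.-1
  else if q == k.*2 then Exit i else DT i.

Lemma lab_line_contact i q : q < k.*2 + 2 -> lab (line_contact i q) = B i + q.
Proof.
rewrite /line_contact => qk; do 3?[case: ifP => /= ?]; lia.
Qed.

Lemma valid_line_contact i q : 0 < i < k -> q < k.*2 + 2 ->
  valid_contact (line_contact i q).
Proof.
rewrite /line_contact => ik qk; do 3?[case: ifP => /= ?]; lia.
Qed.

(* Arrival times from [VS i] once [line_contact i q] is removed; [L.+1] means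
   unreachable. *)
Definition arrival (i q : nat) (v : vertex) : nat :=
  let hub := B 1 + (k - i).*2 in
  let late := B i + k.*2.+1 in
  match v with
  | VA x => if zigrank k i x < q then B i + zigrank k i x else late
  | VS j => if j == i then 0 else if j < i then (B i).+1 else late
  | VD j => if j == 0 then hub else if j < i then B j + k.*2.+1
            else if j == i then (if q == k.*2.+1 then B i + k.*2 else L.+1) else late
  | VT j => if j == i then L.+1 else if j < i then hub else late
  | VE j => if j == i then 1 else if j < i then hub else late
  end.

Lemma arrival_VA_ge i q x : B i <= arrival i q (VA x).
Proof. rewrite /=; case: ifP; lia. Qed.

Lemma arrival_VA_le i q x : i < k -> x < k.*2 -> arrival i q (VA x) <= B i + k.*2.+1.
Proof. move=> ik xk; have := zigrank_lt ik xk; rewrite /=; case: ifP; lia. Qed.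

(** Core arrival times lie in interval [i], so a contact of another line finds both ends informed or
    neither. On line [i] the removed contact separates the informed part from the rest. The hub is
    informed by [CE i], one unit after the time of [CT i]. *)
Lemma arrival_closed i q : 0 < i < k -> q < k.*2 + 2 ->
  {in contacts, forall c, c != line_contact i q ->
     (arrival i q (src c) <= lab c) = (arrival i q (dst c) <= lab c)}.
Proof.
move=> ik qk c; rewrite mem_contacts => hc cq.
have := @start_le 1 i; have := @start_lt i k; have := start0.
have := @start_le (line c) 0.
have := @start_lt 0 1; have := @start_lt 1 2; have := @start_lt 2 k; have := @start_le 2 k.
have := @start_lt i (line c); have := @start_lt (line c) i; have := @start_lt (line c) k.
have := @start_le 1 (line c); have := @start_le i (line c); have := @start_le (line c) i.
move: hc cq => + + H1 H2 H3 H4 H5 H6 H7 H8 H9 H10 H11 H12 H13 H14.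
case: c H1 H2 H3 H4 H5 H6 H7 H8 H9 H10 H11 H12 H13 H14
  => [j|j|j|j|j p|j|j||j|j|j|j|] H1 H2 H3 H4 H5 H6 H7 H8 H9 H10 H11 H12 H13 H14 hc cq.
all: rewrite [line _]/= in H1 H2 H3 H4 H5 H6 H11; rewrite [lab _]/= [src _]/= [dst _]/=.
all: rewrite [valid_contact _]/= in hc.
all: have VAge := arrival_VA_ge i q; have VAle := @arrival_VA_le i q _ (proj2 (andP ik)).
- by rewrite /arrival; iflia.
- by have := VAge j; move: (arrival _ _ (VA j)) => a; rewrite /arrival; iflia.
- by have := VAge (k + j).-1; move: (arrival _ _ (VA _)) => a; rewrite /arrival; iflia.
- have [ji|ji] := eqVneq j i; last first.
    have := VAge j; have := VAle j; move: (arrival _ _ (VA j)) => a.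
    by rewrite /arrival; iflia.
  have q0 : q != 0 by apply: contraNneq cq => q0; rewrite ji /line_contact q0.
  have rk : zigrank k i i = 0 by rewrite -{2}(zigzag0 k i) zigzagK //; lia.
  by rewrite ji /arrival rk eqxx; iflia.
- have [jk pk] := andP hc; have pk' : p < k.*2 by lia.
  have [ji|ji] := eqVneq j i; last first.
    have := VAge (zigzag k j p); have := VAle _ (zigzag_lt jk pk').
    have := VAge (zigzag k j p.+1); have := VAle _ (zigzag_lt jk pk).
    move: (arrival _ _ (VA (zigzag k j p))) => a.
    by move: (arrival _ _ (VA (zigzag k j p.+1))) => a'; lia.
  (* [Path i p] is the line contact of offset [p.+1]; as it is not removed, positions [p] and [p.+1]
     are both below [q] or both not. *)
  have qp : q != p.+1.
    by apply: contraNneq cq => q0; rewrite ji /line_contact q0 /= pk.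
  by move: ji jk => -> jk; rewrite /arrival !zigzagK //; iflia.
- have [ji|ji] := eqVneq j i; last first.
    have := VAge (j + k); have := VAle (j + k); move: (arrival _ _ (VA _)) => a.
    by rewrite /arrival; iflia.
  have qp : q != k.*2.
    apply: contraNneq cq => q0; rewrite ji /line_contact q0 ltnn.
    by do 2?[case: ifP => ?] => //; exfalso; lia.
  have rk : zigrank k i (i + k) = k.*2.-1 by rewrite -zigzag_last ?zigzagK //; lia.
  by rewrite ji /arrival rk; iflia.
- have [ji|ji] := eqVneq j i; last by rewrite /arrival; iflia.
  have qp : q != k.*2.+1.
    apply: contraNneq cq => q0; rewrite ji /line_contact q0 /=.
    by do 2?[case: ifP => ?] => //; exfalso; lia.
  by rewrite ji /arrival; iflia.
- by have := VAge 1; move: (arrival _ _ (VA _)) => a; rewrite /arrival ?eqxx; iflia.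
- by rewrite /arrival ?eqxx; iflia.
- by rewrite /arrival ?eqxx; iflia.
- by have := @start_lt i j; have := @start_lt j k; rewrite /arrival ?eqxx; iflia.
- by have := VAle j; move: (arrival _ _ (VA j)) => a; rewrite /arrival ?eqxx; iflia.
- by have := VAle k; move: (arrival _ _ (VA k)) => a; rewrite /arrival ?eqxx; iflia.
Qed.

Lemma succ_ord_lt (i : 'I_k.-1) : 0 < i.+1 < k.
Proof. by have := ltn_ord i; lia. Qed.

Lemma srcK : {in contacts, forall c, vertex_of (ord_of (src c)) = src c}.
Proof. by move=> c; rewrite mem_contacts => hc; rewrite ord_ofK ?valid_src. Qed.

Lemma dstK : {in contacts, forall c, vertex_of (ord_of (dst c)) = dst c}.
Proof. by move=> c; rewrite mem_contacts => hc; rewrite ord_ofK ?valid_dst. Qed.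

Lemma line_edges_card :
  #|[set edge_of ord_of src dst (line_contact c.1.+1 c.2) |
      c : 'I_k.-1 * 'I_(k.*2 + 2)]| = k.-1 * (k.*2 + 2).
Proof.
rewrite card_imset; first by rewrite card_prod !card_ord.
have valid (c : 'I_k.-1 * 'I_(k.*2 + 2)) : line_contact c.1.+1 c.2 \in contacts.
  rewrite mem_contacts; apply: valid_line_contact => //.
  exact: succ_ord_lt.
move=> c d /(edge_of_inj vertex_ofK srcK dstK contacts_ends_inj (valid c) (valid d)).
case: c d {valid} => i p [j q] /= E.
have {E} : B i.+1 + p = B j.+1 + q by rewrite -!lab_line_contact ?ltn_ord // E.
have := @start_lt i.+1 j.+1; have := @start_lt j.+1 i.+1.
have := @start_le i.+1 j.+1; have := @start_le j.+1 i.+1.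
have := ltn_ord p; have := ltn_ord q => qk pk H1 H2 H3 H4 E.
by congr (_, _); apply: val_inj => /=; lia.
Qed.

Lemma lab_gt0 c : valid_contact c -> 0 < lab c.
Proof.
have := start_ge2 (line c); have := @start_lt 0 k.
have := @start_lt 1 k; have := start0.
by case: c => [j|j|j|j|i q|j|j||j|j|j|j|] /=; lia.
Qed.

Lemma lab_le c : valid_contact c -> lab c <= L.
Proof.
have := @start_lt (line c) k; have := @start_lt 0 k.
have := @start_lt 1 k; have := start0.
by case: c => [j|j|j|j|i q|j|j||j|j|j|j|] /=; lia.
Qed.

Lemma line_graph : exists G : tgraph 'I_(3 * k.*2),
    tg_wf G /\ happy G /\
        #|tedges G| = k.*2 * (k.*2 + 9) %/ 2 - 3 /\
        (forall e t, e \in tedges G -> tlab G e t ->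
           1 <= t <= k.*2 * (k.*2 + 5) %/ 2 - 1) /\
        temporally_connected G /\
        forall F : {set {set 'I_(3 * k.*2)}},
          F \subset tedges G -> #|F| = 5 * k.*2 ->
          ~ temporally_connected (remove_edges G F).
Proof.
have half_mul x : k.*2 * x %/ 2 = k * x by rewrite -muln2 mulnAC mulnK.
rewrite !half_mul; exists (contact_graph ord_of src dst lab contacts); split.
  exact: (contact_graph_wf vertex_ofK srcK dstK contacts_loopless).
split; first split.
- exact: (contact_graph_proper vertex_ofK srcK dstK contacts_lab_inj).
- exact: (contact_graph_simple vertex_ofK srcK dstK contacts_ends_inj).
have card_edges : #|tedges (contact_graph ord_of src dst lab contacts)| = k * (k.*2 + 9) - 3.
  rewrite (card_contact_graph _ vertex_ofK srcK dstK contacts_ends_inj contacts_uniq).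
  exact: size_contacts.
split=> //; split.
  move=> e t _ /hasP[c]; rewrite mem_contacts => hc /andP[_ /eqP <-].
  (* The largest label is [L], which leaves a slack of [3k - 3]. *)
  have -> : k * (k.*2 + 5) - 1 = L + 3 * k - 3 by rewrite /start; nia.
  by rewrite lab_gt0 //=; have := lab_le hc; lia.
split.
  apply: (contact_graph_connected vertex_ofK) => u v.
  by rewrite !codom_vertex_of => hu hv _; apply: contacts_reach.
move=> F F_sub F_card conn.
(* If [F] missed all critical edges, then [10k + (k-1)(2k+2) <= k(2k+9) - 3], that is,
   [k + 1 <= 0]. *)
suff crit_notin i q : 0 < i < k -> q < k.*2 + 2 ->
    edge_of ord_of src dst (line_contact i q) \notin F.
  pose crit := [set edge_of ord_of src dst (line_contact c.1.+1 c.2) |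
                 c : 'I_k.-1 * 'I_(k.*2 + 2)].
  have : F :|: crit \subset tedges (contact_graph ord_of src dst lab contacts).
    rewrite subUset F_sub; apply/subsetP => _ /imsetP[c _ ->].
    rewrite inE map_f // mem_contacts; apply: valid_line_contact => //.
    exact: succ_ord_lt.
  move/subset_leq_card; rewrite cardsU disjoint_setI0 ?cards0 ?subn0.
    by rewrite card_edges F_card line_edges_card -!muln2; nia.
  rewrite disjoint_sym disjoints_subset; apply/subsetP => _ /imsetP[c _ ->].
  by rewrite inE; apply: crit_notin => //; apply: succ_ord_lt.
move=> ik qk; apply/negP => eF.
have [_ ik'] := andP ik.
apply: (contact_critical (u := VS i) (v := VT i) vertex_ofK srcK dstK _ _ _ _ _
         (arrival_closed ik qk) eF conn).
- by rewrite codom_vertex_of.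
- by rewrite codom_vertex_of.
- by apply/eqP.
- by rewrite /= eqxx.
- by move=> c; rewrite mem_contacts /= eqxx ltnS; apply: lab_le.
Qed.
End Construction.

(** * The case [n = 2], by computation *)

Section Flood.
Variables (T C : eqType) (src dst : C -> T) (lab : C -> nat) (cs : seq C).

Fixpoint flood (s : seq C) (known : seq T) : seq T :=
  if s is c :: s' then
    flood s' (if (src c \in known) || (dst c \in known)
              then [:: src c, dst c & known] else known)
  else known.

(** One pass in order of labels is sound: every known vertex can wait until the label of the contact
    being processed. *)
Lemma flood_reach u a b s known : {subset s <= cs} -> path leq b (map lab s) ->
  (forall v, v \in known -> reach src dst lab cs u a v b) ->
  forall v, v \in flood s known -> exists b', reach src dst lab cs u a v b'.
Proof.
elim: s b known => [|c s IH] b known sub /=; first by move=> _ h v /h; exists b.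
case/andP => bc path_s h; have ccs : c \in cs by apply: sub; rewrite mem_head.
have {}sub : {subset s <= cs} by move=> d ds; apply: sub; rewrite inE ds orbT.
apply: (IH (lab c)) => // v.
have wait w : w \in known -> reach src dst lab cs u a w (lab c).
  by move/h => r; apply: reach_wait r bc.
case: ifP => [|_]; last exact: wait.
case/orP => /h r; rewrite !inE => /or3P[/eqP->|/eqP->|]; try exact: wait.
- exact: reach_wait r bc.
- exact: reach_fwd r ccs bc.
- exact: reach_bwd r ccs bc.
- exact: reach_wait r bc.
Qed.
End Flood.

(* Two leaves, 4 and 5, feed a gossiping 4-cycle and are then served by it. *)
Definition six_contacts : seq (nat * nat * nat) :=
  [:: (4, 1, 1); (5, 2, 1); (0, 1, 2); (2, 3, 2);
      (0, 2, 3); (1, 3, 3); (4, 0, 4); (5, 1, 4)].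

Lemma six_vertex_graph : exists G : tgraph 'I_(3 * 2),
  [/\ tg_wf G, happy G, #|tedges G| = 8,
      forall e t, e \in tedges G -> tlab G e t -> 1 <= t <= 6 &
      temporally_connected G].
Proof.
pose src (c : nat * nat * nat) := c.1.1; pose dst (c : nat * nat * nat) := c.1.2.
pose lab (c : nat * nat * nat) := c.2.
pose f : nat -> 'I_6 := @inord 5; pose g := @nat_of_ord 6.
have gK : cancel g f by move=> x; apply: inord_val.
have srcK : {in six_contacts, forall c, g (f (src c)) = src c}.
  move=> c c_in; rewrite /g /f inordK //.
  by apply: (allP (_ : all (fun c => src c < 6) _) c c_in).
have dstK : {in six_contacts, forall c, g (f (dst c)) = dst c}.
  move=> c c_in; rewrite /g /f inordK //.
  by apply: (allP (_ : all (fun c => dst c < 6) _) c c_in).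
have ends_inj : {in six_contacts &, forall c c', ends src dst c =i ends src dst c' -> c = c'}.
  move=> c c' c_in c'_in E.
  (* Inclusion of ends already forces equality here, and is decidable by computation. *)
  have check : all (fun c => all (fun c' =>
      (src c \in ends src dst c') && (dst c \in ends src dst c') ==> (c == c'))
      six_contacts) six_contacts by [].
  have := allP (allP check c c_in) c' c'_in.
  by rewrite -!E !inE !eqxx orbT => /eqP.
exists (contact_graph f src dst lab six_contacts); split.
- apply: (contact_graph_wf gK srcK dstK) => c c_in.
  by apply: (allP (_ : all (fun c => src c != dst c) _) c c_in).
- split; last exact: (contact_graph_simple gK srcK dstK ends_inj).
  apply: (contact_graph_proper gK srcK dstK) => c c' c_in c'_in v v_c v_c' lab_eq.
  have check : all (fun c => all (fun c' => (lab c == lab c') &&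
      has (fun v => v \in ends src dst c') [:: src c; dst c] ==> (c == c'))
      six_contacts) six_contacts by [].
  have /implyP := allP (allP check c c_in) c' c'_in.
  rewrite lab_eq eqxx => h; apply/eqP/h/hasP; exists v => //.
  by move: v_c; rewrite !inE.
- by rewrite (card_contact_graph _ gK srcK dstK ends_inj).
- move=> e t _ /hasP[c c_in /andP[_ /eqP <-]].
  by apply: (allP (_ : all (fun c => 1 <= lab c <= 6) _) c c_in).
- apply: (contact_graph_connected gK) => _ _ /codomP[x ->] /codomP[y ->] _.
  apply: (@flood_reach _ _ src dst lab six_contacts (g x) 0 0 six_contacts [:: g x]) => //.
    by move=> v; rewrite inE => /eqP ->; apply: reach_here.
  (* All 36 pairs are checked by evaluating [flood]. *)
  have check : all (fun x => all (fun y => y \in flood src dst six_contacts [:: x])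
      (iota 0 6)) (iota 0 6) by [].
  by apply: (allP (allP check _ _)); rewrite mem_iota /= /g ltn_ord.
Qed.

Theorem mainTheorem16 (n : nat) :
  2 <= n -> ~~ odd n ->
  exists G : tgraph 'I_(3 * n),
    tg_wf G /\ happy G /\
        #|tedges G| = n * (n + 9) %/ 2 - 3 /\
        (forall e t, e \in tedges G -> tlab G e t ->
           1 <= t <= n * (n + 5) %/ 2 - 1) /\
        temporally_connected G /\
        forall F : {set {set 'I_(3 * n)}},
          F \subset tedges G -> #|F| = 5 * n ->
          ~ temporally_connected (remove_edges G F).
Proof.
move=> n_ge2 n_even; rewrite -(even_halfK n_even).
have [k_gt1|k_le1] := ltnP 1 n./2; first exact: line_graph.
have -> : n./2 = 1 by lia.
have [G [wf hG card labs conn]] := six_vertex_graph.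
exists G; do 5?split=> //.
by move=> F /subset_leq_card; rewrite card => + F_card; rewrite F_card.
Qed.
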